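(* Let $X$ be a separable Banach space and let $T\colon X\to X$ be a hypercyclic bounded linear operator. Then exactly one of the following four assertions holds: (1) every vector in $X$ is asymptotic to zero with density one for $T$; (2) generic vectors in $X$ are distributionally irregular of type $1$ for $T$; (3) generic vectors in $X$ are distributionally irregular of type $2\frac{1}{2}$ for $T$, and no hypercyclic vector of $T$ is distributionally irregular of type $1$ for $T$; (4) every hypercyclic vector of $T$ in $X$ is divergent to infinity with density one for $T$.
   Context: Densities: for $A\subset\mathbb{N}$, the upper and lower densities are $\overline{\mathrm{dens}}(A)=\limsup_{n\to\infty}\frac{\#(A\cap[1,n])}{n}$ and $\underline{\mathrm{dens}}(A)=\liminf_{n\to\infty}\frac{\#(A\cap[1,n])}{n}$. If they are equal, the density of $A$ exists and the common value is denoted $\mathrm{dens}(A)$. Let $X$ be a Banach space with norm $\|\cdot\|$ (over $\mathbb{R}$ or $\mathbb{C}$) and let $T\colon X\to X$ be a bounded linear operator. A vector $x\in X$ is hypercyclic for $T$ if its orbit $\{T^nx: n\ge 0\}$ is dense in $X$; $T$ is hypercyclic if it has a hypercyclic vector. A vector $x\in X$ is: - distributionally irregular of type $1$ for $T$ if there exist $A,B\subset\mathbb{N}$ with $\overline{\mathrm{dens}}(A)=\overline{\mathrm{dens}}(B)=1$, $\lim_{A\ni n\to\infty}\|T^nx\|=0$ and $\lim_{B\ni n\to\infty}\|T^nx\|=\infty$; - distributionally irregular of type $2\frac12$ for $T$ if there exist $A,B\subset\mathbb{N}$ with $\overline{\mathrm{dens}}(A)\,\overline{\mathrm{dens}}(B)>0$,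 $\lim_{A\ni n\to\infty}\|T^nx\|=0$ and $\lim_{B\ni n\to\infty}\|T^nx\|=\infty$; - asymptotic to zero with density one if there exists $A\subset\mathbb{N}$ with $\mathrm{dens}(A)=1$ and $\lim_{A\ni n\to\infty}\|T^nx\|=0$; - divergent to infinity with density one if there exists $B\subset\mathbb{N}$ with $\mathrm{dens}(B)=1$ and $\lim_{B\ni n\to\infty}\|T^nx\|=\infty$. ''Generic vectors in $X$ have property P'' means that the set of vectors in $X$ satisfying P contains a dense $G_\delta$ subset of $X$. *)

(* Defs.v *)
From HB Require Import structures.
From mathcomp Require Import all_boot all_order all_algebra complex.
From mathcomp Require Import all_classical all_reals all_analysis.
From mathcomp Require Import borel_hierarchy.

Set Implicit Arguments.
Unset Strict Implicit.
Unset Printing Implicit Defensive.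

Import Order.TTheory GRing.Theory Num.Theory.
Import numFieldNormedType.Exports.

Local Open Scope classical_set_scope.
Local Open Scope ring_scope.

Section Density.
Variable R : realType.
Implicit Types A : set nat.

(* The term of index 0 is 0 / 0 = 0; it does not affect the limits. *)
Definition counting_ratio A : R^nat :=
  fun n => (\sum_(1 <= k < n.+1) (k \in A))%N%:R / n%:R.

(* [limn_sup] and [limn_inf] are the genuine limits superior and inferior
   because the ratios lie in [0, 1]. *)
Definition upper_density A : R := limn_sup (counting_ratio A).

Definition lower_density A : R := limn_inf (counting_ratio A).

Definition has_density A (d : R) : Prop :=
  upper_density A = d /\ lower_density A = d.

End Density.

Definition separable (X : topologicalType) : Prop :=
  exists2 D : set X, countable D & dense D.

Definition generic (X : topologicalType) (P : set X) : Prop :=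
  exists G : set X, [/\ Gdelta G, dense G & G `<=` P].

Section Orbits.
Variables (K : numFieldType) (X : normedModType K) (T : {linear X -> X}).
Implicit Types (x : X) (A B : set nat).

Definition bounded_operator : Prop :=
  exists M : K, forall x, `|T x| <= M * `|x|.

Definition hypercyclic_vector x : Prop :=
  dense (range (fun n : nat => iter n T x)).

Definition hypercyclic : Prop := exists x, hypercyclic_vector x.

(* Norms are elements of the scalar field [K]. When [K] is complex, [+oo] is
   the filter generated by the sets of real numbers above a real bound. *)
Definition norm_cvg0_along A x : Prop :=
  (fun n : nat => `|iter n T x|) @ within A \oo --> (0 : K).

Definition norm_cvgy_along A x : Prop :=
  (fun n : nat => `|iter n T x|) @ within A \oo --> (+oo : set_system K).

Variable R : realType.

Definition distr_irregular1 x : Prop :=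
  exists A B : set nat,
    [/\ upper_density R A = 1, upper_density R B = 1,
        norm_cvg0_along A x & norm_cvgy_along B x].

Definition distr_irregular2half x : Prop :=
  exists A B : set nat,
    [/\ 0 < upper_density R A * upper_density R B,
        norm_cvg0_along A x & norm_cvgy_along B x].

Definition asymptotic_to_zero_density1 x : Prop :=
  exists2 A : set nat, has_density A (1 : R) & norm_cvg0_along A x.

Definition divergent_to_infinity_density1 x : Prop :=
  exists2 B : set nat, has_density B (1 : R) & norm_cvgy_along B x.

End Orbits.

Definition exactly_one4 (P1 P2 P3 P4 : Prop) : Prop :=
  [\/ P1, P2, P3 | P4] /\
  [/\ ~ (P1 /\ P2), ~ (P1 /\ P3) & ~ (P1 /\ P4)] /\
  [/\ ~ (P2 /\ P3), ~ (P2 /\ P4) & ~ (P3 /\ P4)].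

Section Alternatives.
Variables (R : realType) (K : numFieldType).
Variables (X : normedModType K) (T : {linear X -> X}).

Definition exactly_one_orbit_alternative : Prop :=
  exactly_one4
    (forall x : X, asymptotic_to_zero_density1 T R x)
    (generic [set x | distr_irregular1 T R x])
    (generic [set x | distr_irregular2half T R x] /\
     forall x : X, hypercyclic_vector T x -> ~ distr_irregular1 T R x)
    (forall x : X, hypercyclic_vector T x ->
       divergent_to_infinity_density1 T R x).

End Alternatives.

(* Main.v *)
Require Import Defs.
From mathcomp Require Import all_boot all_order all_algebra complex.
From mathcomp Require Import all_classical all_reals all_analysis.
From mathcomp Require Import borel_hierarchy.
From mathcomp Require Import lra.

Set Implicit Arguments.
Unset Strict Implicit.
Unset Printing Implicit Defensive.

Import Order.TTheory GRing.Theory Num.Theory.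
Import numFieldNormedType.Exports.

Local Open Scope classical_set_scope.
Local Open Scope ring_scope.

(** Call a set of integers c-frequent when its upper density is at least c.
The theorem rests on one remark: for an open set P, the vectors whose orbit
visits P along a c-frequent set of times form a G_delta set, because only
finitely many iterates are involved in each approximation of the density, and
this set is invariant under T. So if it contains one hypercyclic vector, it
contains a whole dense orbit, and it is generic ([generic_frequent]).

Apply this to the balls P = { |y| < 1/(j+1) } and to the exteriors
P = { |y| > j }. A nonzero multiple of a hypercyclic vector is hypercyclic, and
rescaling turns visits to one exterior into visits to another, with the same
density. There are three cases.
- All hypercyclic vectors leave every ball around 0 along sets of density zero
  only. Every vector is the sum of two hypercyclic ones, by the Baire category
  theorem, so every vector is asymptotic to zero with density one
  ([all_asymptotic]).
- All hypercyclic vectors return to every ball around 0, however large, along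
  sets of density zero only. Then they diverge to infinity with density one
  ([negligible_divergent]).
- Otherwise some hypercyclic vector stays out of some ball around 0 with a
  positive upper density d. Its multiples show that, for each j, some
  hypercyclic vector is d-frequently in { |y| > j }, so the generic vector is so
  for all j at once ([not_negligible_generic_large]). In the same way the
  generic vector is c-frequently in { |y| < 1/(j+1) } for all j, with c > 0
  independent of j. A diagonal argument ([frequent_diagonal]) merges the visits
  for all j into one set of times along which the norms tend to infinity, or to
  0: the generic vector is irregular of type 2 1/2. If moreover one hypercyclic
  vector is irregular of type 1, the remark with c = 1 makes the generic vector
  so.

The alternatives exclude each other because a set of density one meets every
set of positive upper density in infinitely many points
([frequent_meets_density1]), and because the hypercyclic vectors are themselves
generic ([hypercyclic_generic]). *)

(** * Counting in sets of integers *)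

Section Counting.
Implicit Types (A B : set nat) (n : nat).

Definition count_upto A n := (\sum_(1 <= k < n.+1) (k \in A))%N.

Lemma count_uptoS A n : count_upto A n.+1 = (count_upto A n + (n.+1 \in A))%N.
Proof. by rewrite /count_upto big_nat_recr. Qed.

Lemma count_upto0 A : count_upto A 0 = 0%N.
Proof. by rewrite /count_upto big_geq. Qed.

Lemma count_upto_le_on A B n :
  (forall k, (1 <= k <= n)%N -> A k -> B k) ->
  (count_upto A n <= count_upto B n)%N.
Proof.
move=> AB; rewrite /count_upto big_nat [leqRHS]big_nat.
apply: leq_sum => k; rewrite ltnS => kn.
have [/set_mem Ak|//] := boolP (k \in A).
by rewrite (mem_set (AB _ kn Ak)).
Qed.

Lemma count_upto_leU A B n :
  (count_upto (A `|` B) n <= count_upto A n + count_upto B n)%N.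
Proof.
rewrite /count_upto -big_split; apply: leq_sum => k _.
by rewrite in_setU; case: (k \in A); case: (k \in B).
Qed.

Lemma count_uptoC A n : (count_upto A n + count_upto (~` A) n)%N = n.
Proof.
rewrite /count_upto -big_split /= big_nat.
rewrite (eq_bigr (fun=> 1%N)); last by move=> k _; rewrite in_setC; case: (k \in A).
by rewrite -big_nat sum_nat_const_nat muln1 subn1.
Qed.

Lemma count_upto_le A n : (count_upto A n <= n)%N.
Proof. by rewrite -[leqRHS](count_uptoC A) leq_addr. Qed.

Lemma count_upto_initial N n : (count_upto [set k | (k <= N)%N] n <= N)%N.
Proof.
elim: n => [|n IH]; first by rewrite count_upto0.
have [nN|Nn] := leqP n.+1 N; first exact: leq_trans (count_upto_le _ _) nN.
rewrite count_uptoS memNset ?addn0//=.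
by apply/negP; rewrite -ltnNge.
Qed.

(** Shifting a set by m loses at most its elements up to m. *)
Lemma count_upto_shift A m n :
  (count_upto A n <= count_upto [set k | A (k + m)%N] n + m)%N.
Proof.
have mono p : (count_upto A n <= count_upto A (n + p))%N.
  by elim: p => [|p IH]; rewrite ?addn0// addnS count_uptoS (leq_trans IH)// leq_addr.
apply: (leq_trans (mono m)).
elim: n {mono} => [|n IH]; first by rewrite count_upto0 !add0n count_upto_le.
by rewrite addSn !count_uptoS -addSn [leqRHS]addnAC leq_add.
Qed.

End Counting.

(** * Upper density and sets of density zero *)

Section Densities.
Variable R : realType.
Implicit Types (A B : set nat) (c e : R) (n N : nat).

(** The inequality c <= upper_density A, unwound: only finite counts appear in
it, which is what makes it a G_delta condition on a vector. *)
Definition frequent c A := forall e N, 0 < e ->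
  exists2 n, (N <= n)%N & (c - e) * n%:R < (count_upto A n)%:R.

Definition negligible_set A := forall e, 0 < e ->
  exists N, forall n, (N <= n)%N -> (count_upto A n)%:R <= e * n%:R.

Lemma linear_dominates a e : 0 < e ->
  exists M, forall n, (M <= n)%N -> a < e * n%:R.
Proof.
move=> e0; exists (Num.bound (`|a| / e)) => n Mn.
apply: (le_lt_trans (ler_norm a)); rewrite -ltr_pdivrMl// mulrC.
apply: (@lt_le_trans _ _ (Num.bound (`|a| / e))%:R); last by rewrite ler_nat.
by apply: archi_boundP; rewrite divr_ge0// ltW.
Qed.

Lemma inv_nat_eventually_lt e : 0 < e ->
  exists M, forall n, (M <= n)%N -> n.+1%:R^-1 < e.
Proof.
move=> e0; have [M HM] := linear_dominates 1 e0; exists M => n Mn.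
by have := HM n.+1 (leqW Mn); rewrite -ltr_pdivrMr ?div1r.
Qed.

Lemma counting_ratioE A n : counting_ratio R A n = (count_upto A n)%:R / n%:R.
Proof. by []. Qed.

Lemma counting_ratio_itv A n : 0 <= counting_ratio R A n <= 1.
Proof.
rewrite counting_ratioE divr_ge0//=; case: n => [|n].
  by rewrite count_upto0 mul0r.
by rewrite ler_pdivrMr ?ltr0n// mul1r ler_nat count_upto_le.
Qed.

Lemma bounded_counting_ratio A : bounded_fun (counting_ratio R A).
Proof.
exists 1; split => // x x1 n _ /=; have /andP[h0 h1] := counting_ratio_itv A n.
by rewrite ger0_norm// (le_trans h1)// ltW.
Qed.

(** The index of the ratio has to be positive to clear the denominator, hence
the [maxn N 1] below. *)
Lemma upper_density_geP c A : c <= upper_density R A <-> frequent c A.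
Proof.
have bu := bounded_counting_ratio A.
rewrite /upper_density limn_supE//; split=> [cu e N e0|fA].
  have : c - e < sups (counting_ratio R A) (maxn N 1).
    rewrite (@lt_le_trans _ _ c) ?ltrBlDr ?ltrDl//.
    apply: (le_trans cu); apply: ge_inf; first exact: bounded_fun_has_lbound_sups.
    by exists (maxn N 1).
  move=> /sup_gt [|_ [n /= + <-] cn].
    by exists (counting_ratio R A (maxn N 1)) => /=; exists (maxn N 1) => /=.
  rewrite geq_max => /andP[Nn n0]; exists n => //.
  by move: cn; rewrite counting_ratioE ltr_pdivlMr ?ltr0n.
apply: lb_le_inf; first by exists (sups (counting_ratio R A) 0); exists 0%N.
move=> _ [N _ <-]; apply/ler_addgt0Pr => e e0; rewrite -lerBlDr.
have [n] := fA _ (maxn N 1) e0; rewrite geq_max => /andP[Nn n0] cn.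
apply: (@le_trans _ _ (counting_ratio R A n)).
  by rewrite ltW// counting_ratioE ltr_pdivlMr ?ltr0n.
apply: ub_le_sup; last by exists n.
exact/has_ubound_sdrop/bounded_fun_has_ubound.
Qed.

Lemma frequent_le1 c A : frequent c A -> c <= 1.
Proof.
move=> fA; rewrite leNgt; apply/negP => c1.
have [|n n1] := fA ((c - 1) / 2) 1%N; first by lra.
apply/negP; rewrite -leNgt (@le_trans _ _ n%:R) ?ler_nat ?count_upto_le//.
by rewrite ler_peMl//; lra.
Qed.

Lemma upper_density_eq1P A : upper_density R A = 1 <-> frequent 1 A.
Proof.
split=> [<-|/upper_density_geP u1]; first exact/upper_density_geP.
apply/eqP; rewrite eq_le u1 andbT.
exact/frequent_le1/upper_density_geP.
Qed.

Lemma upper_density_ge0 A : 0 <= upper_density R A.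
Proof.
apply/upper_density_geP => e N e0; exists N.+1 => //.
by rewrite (@lt_le_trans _ _ 0)// sub0r mulNr oppr_lt0 mulr_gt0.
Qed.

Lemma has_density1P A : has_density A (1 : R) <-> negligible_set (~` A).
Proof.
have bu := bounded_counting_ratio A.
have E n : (count_upto (~` A) n)%:R = n%:R - (count_upto A n)%:R :> R.
  by rewrite -{2}(count_uptoC A n) natrD addrAC subrr add0r.
split=> [[_]|nA].
  rewrite /lower_density limn_infE// => l1 e e0.
  have [||_ [N _ <-] eN] := @sup_gt _ (range (infs (counting_ratio R A))) (1 - e).
    by exists (infs (counting_ratio R A) 0), 0%N.
    by rewrite l1 ltrBlDr ltrDl.
  exists (maxn N 1) => n; rewrite geq_max => /andP[Nn n0].
  have : 1 - e < counting_ratio R A n.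
    apply: (lt_le_trans eN); apply: ge_inf; last by exists n.
    exact/has_lbound_sdrop/bounded_fun_has_lbound.
  by rewrite counting_ratioE E ltr_pdivlMr ?ltr0n//; lra.
suff /cvg_limn_inf_sup[? ?] : counting_ratio R A @ \oo --> (1 : R) by split.
apply/cvgrPdist_le => e e0; have [N HN] := nA _ e0.
exists (maxn N 1) => // n /=; rewrite geq_max => /andP[Nn n0].
have := HN _ Nn; have /andP[_ h1] := counting_ratio_itv A n.
rewrite E ger0_norm ?subr_ge0// => h2.
by rewrite lerBlDr -lerBlDl counting_ratioE ler_pdivlMr ?ltr0n//; lra.
Qed.

Lemma frequent_sub c A B : (forall k, A k -> B k) -> frequent c A -> frequent c B.
Proof.
move=> AB fA e N e0; have [n Nn An] := fA e N e0; exists n => //.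
by apply: (lt_le_trans An); rewrite ler_nat; apply: count_upto_le_on => k _; exact: AB.
Qed.

Lemma negligible_sub A B : (forall k, A k -> B k) ->
  negligible_set B -> negligible_set A.
Proof.
move=> AB nB e e0; have [N HN] := nB e e0; exists N => n Nn.
by apply: le_trans (HN n Nn); rewrite ler_nat; apply: count_upto_le_on => k _; exact: AB.
Qed.

Lemma negligibleU A B : negligible_set A -> negligible_set B ->
  negligible_set (A `|` B).
Proof.
move=> nA nB e e0; have e20 : 0 < e / 2 by lra.
have [[N HN] [M HM]] := (nA _ e20, nB _ e20).
exists (maxn N M) => n; rewrite geq_max => /andP[/HN h1 /HM h2].
apply: (@le_trans _ _ (count_upto A n + count_upto B n)%:R).
  by rewrite ler_nat count_upto_leU.
by rewrite natrD; lra.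
Qed.

(** The failure of density zero already provides the constant c: counts above
c * n occur for arbitrarily large n. *)
Lemma not_negligible A : ~ negligible_set A -> exists2 c, 0 < c & frequent c A.
Proof.
move=> /existsNP[c /not_implyP[c0 /forallNP H]]; exists c => // e N e0.
have /existsNP[n /not_implyP[Nn /negP]] := H N; rewrite -ltNge => cn.
by exists n => //; apply: le_lt_trans cn; rewrite ler_wpM2r//; lra.
Qed.

(** This makes the frequency of visits the same along an orbit. *)
Lemma frequent_shift c A m : frequent c A -> frequent c [set k | A (k + m)%N].
Proof.
move=> fA e N e0; have e20 : 0 < e / 2 by lra.
have [M HM] := linear_dominates m%:R e20.
have [n] := fA _ (maxn N M) e20.
rewrite geq_max => /andP[Nn /HM mn] An; exists n => //.
have : (count_upto A n)%:R <= (count_upto [set k | A (k + m)%N] n)%:R + m%:R :> R.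
  by rewrite -natrD ler_nat count_upto_shift.
nra.
Qed.

Lemma frequent_eventually c A B :
  (exists N, forall k, (N < k)%N -> A k -> B k) -> frequent c A -> frequent c B.
Proof.
move=> [N0 AB] fA e N e0; have e20 : 0 < e / 2 by lra.
have [M HM] := linear_dominates N0%:R e20.
have [n] := fA _ (maxn N M) e20.
rewrite geq_max => /andP[Nn /HM N0n] An; exists n => //.
have : (count_upto A n)%:R <= (count_upto B n)%:R + N0%:R :> R.
  rewrite -natrD ler_nat.
  apply: leq_trans (leq_add (leqnn _) (count_upto_initial N0 n)).
  apply: leq_trans (count_upto_leU _ _ _); apply: count_upto_le_on => k _ Ak.
  by have [/AB/(_ Ak)|] := ltnP N0 k; [left|right].
nra.
Qed.

(** If A and B had no common element beyond N, then A would be contained in the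
union of [0, N] and the complement of B, which has density zero. *)
Lemma frequent_meets_density1 c A B : 0 < c -> frequent c A ->
  negligible_set (~` B) -> forall N, exists2 k, (N <= k)%N & A k /\ B k.
Proof.
move=> c0 fA nB N; apply: contrapT => H.
have AB k : A k -> ([set k | (k <= N)%N] `|` ~` B) k.
  move=> Ak; have [Nk|/ltnW ?] := leqP N k; last by left.
  by right => Bk; apply: H; exists k.
have nI : negligible_set [set k | (k <= N)%N].
  move=> e e0; have [M HM] := linear_dominates N%:R e0; exists M => n Mn.
  by rewrite (le_trans _ (ltW (HM n Mn)))// ler_nat count_upto_initial.
have c30 : 0 < c / 3 by lra.
have [M HM] := negligible_sub AB (negligibleU nI nB) c30.
have [n Mn] := fA _ M c30; apply/negP; rewrite -leNgt (le_trans (HM n Mn))//.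
by rewrite ler_wpM2r//; lra.
Qed.

(** A set A almost contained in all the S j that is as frequent as they are.
Choose N_0 < N_1 < ... so that N_(j+1) is a time at which S j is nearly
c-frequent even after discarding its elements up to N_j, and impose membership
in S j only beyond N_j. By monotonicity the elements of S j in ]N_j, N_(j+1)]
satisfy all the conditions imposed on them. *)
Lemma frequent_diagonal c (S : nat -> set nat) :
  (forall i j, (i <= j)%N -> S j `<=` S i) -> (forall j, frequent c (S j)) ->
  exists2 A, frequent c A & forall j, exists N, forall k, (N < k)%N -> A k -> S j k.
Proof.
move=> Sd Sf.
have step (jN : nat * nat) : exists n, (jN.2 < n)%N /\
    (c - jN.1.+1%:R^-1) * n%:R < (count_upto (S jN.1) n)%:R - jN.2%:R.
  case: jN => j N /=; set e := j.+1%:R^-1.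
  have e20 : 0 < e / 2 :> R by rewrite divr_gt0// invr_gt0.
  have [M HM] := linear_dominates N%:R e20.
  have [n] := Sf j _ (maxn N.+1 M) e20.
  rewrite geq_max => /andP[Nn /HM Bn] An; exists n; split => //.
  by move: An Bn; nra.
have [f Hf] := choice step.
pose N_ := fix N_ j := if j is i.+1 then f (i, N_ i) else 0%N.
have Nlt j : (N_ j < N_ j.+1)%N by have [] := Hf (j, N_ j).
have Nmono : {mono N_ : i j / (i <= j)%N}.
  by apply: leq_mono; apply: homo_ltn Nlt; exact: ltn_trans.
have Nge j : (j <= N_ j)%N by elim: j => // j /leq_ltn_trans; apply.
exists [set k | forall j, (N_ j < k)%N -> S j k]; last first.
  by move=> j; exists (N_ j) => k Nk; apply.
move=> e N e0; have [M HM] := inv_nat_eventually_lt e0.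
pose j := maxn N M.
exists (N_ j.+1).
  by rewrite (leq_trans (leq_maxl N M))// (leq_trans _ (Nge _)).
have je : j.+1%:R^-1 < e by apply: HM; exact: leq_maxr.
have [_] := Hf (j, N_ j).
rewrite -/(N_ j.+1) [_.1]/= [_.2]/= => Aj.
apply: (@le_lt_trans _ _ ((c - j.+1%:R^-1) * (N_ j.+1)%:R)).
  by rewrite ler_wpM2r// lerD2l lerN2 ltW.
apply: (lt_le_trans Aj); rewrite lerBlDr -natrD ler_nat.
have := count_upto_leU [set k | forall i, (N_ i < k)%N -> S i k]
  [set k | (k <= N_ j)%N] (N_ j.+1).
move=> /leq_trans-/(_ _ (leq_add (leqnn _) (count_upto_initial _ _))).
apply: leq_trans; apply: count_upto_le_on => k /andP[_ kj] Sk.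
have [Nk|/ltnW ?] := leqP k (N_ j); first by right.
left => i ik; apply: Sd Sk; rewrite -ltnS ltnNge -Nmono -ltnNge.
exact: leq_trans ik kj.
Qed.

(** The same construction for sets of density one. Here N_j is a time after
which the complement of S j counts for at most n / (j+1), and for n in
[N_j, N_(j+1)] the integers up to n outside of A all lie outside of S j. *)
Lemma negligible_diagonal (S : nat -> set nat) :
  (forall i j, (i <= j)%N -> S j `<=` S i) ->
  (forall j, negligible_set (~` S j)) ->
  exists2 A, negligible_set (~` A) &
    forall j, exists N, forall k, (N < k)%N -> A k -> S j k.
Proof.
move=> Sd Sn.
have step (jN : nat * nat) : exists n, (jN.2 < n)%N /\
    forall m, (n <= m)%N -> (count_upto (~` S jN.1) m)%:R <= jN.1.+1%:R^-1 * m%:R :> R.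
  case: jN => j N /=.
  have [|M HM] := Sn j j.+1%:R^-1; first by rewrite invr_gt0.
  exists (maxn N.+1 M); rewrite leq_maxl; split => // m.
  by rewrite geq_max => /andP[_ /HM].
have [f Hf] := choice step.
pose N_ := fix N_ j := if j is i.+1 then f (i.+1, N_ i) else f (0, 0)%N.
have Nlt j : (N_ j < N_ j.+1)%N by have [] := Hf (j.+1, N_ j).
have Nmono : {mono N_ : i j / (i <= j)%N}.
  by apply: leq_mono; apply: homo_ltn Nlt; exact: ltn_trans.
have Nge j : (j <= N_ j)%N by elim: j => // j /leq_ltn_trans; apply.
have Ncount j m : (N_ j <= m)%N ->
    (count_upto (~` S j) m)%:R <= j.+1%:R^-1 * m%:R :> R.
  by case: j => [|j]; [have [_ +] := Hf (0, 0)%N|have [_ +] := Hf (j.+1, N_ j)]; apply.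
exists [set k | forall j, (N_ j < k)%N -> S j k]; last first.
  by move=> j; exists (N_ j) => k Nk; apply.
move=> e e0; have [M HM] := inv_nat_eventually_lt e0.
exists (N_ M) => n Mn.
have bound i : (N_ i <= n)%N -> (i <= n)%N by exact: leq_trans (Nge i).
(* j is the stage that n has reached: N_ j <= n < N_ j.+1. *)
have [j Njn jmax] := ex_maxnP (ex_intro (fun i => N_ i <= n)%N M Mn) bound.
have Mj : (M <= j)%N by exact: jmax.
apply: (@le_trans _ _ (j.+1%:R^-1 * n%:R)); last first.
  by rewrite ler_wpM2r// ltW// HM.
apply: le_trans (Ncount _ _ Njn); rewrite ler_nat.
apply: count_upto_le_on => k /andP[_ kn] /existsNP[i /not_implyP[ik Sk]] Sjk.
by apply: Sk; apply: Sd Sjk; apply: jmax; exact: leq_trans (ltnW ik) kn.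
Qed.

End Densities.

(** * Generic sets in a Banach space *)

(** Norms take their values in the scalar field. This form of the archimedean
property lets one work with the radii 1/(n+1) alone, uniformly for real and
complex scalars. *)
Definition inv_nat_cofinal (K : numFieldType) : Prop :=
  forall e : K, 0 < e -> exists n, n.+1%:R^-1 < e.

Section Balls.
Variables (K : numFieldType) (X : normedModType K).
Hypothesis archK : inv_nat_cofinal K.
Implicit Type x : X.

Lemma open_ball_inside (A : set X) x : open A -> A x ->
  exists n, forall y, `|x - y| < n.+1%:R^-1 -> A y.
Proof.
move=> oA Ax; have /nbhs_normP[e /= e0 eA] := open_nbhs_nbhs (conj oA Ax).
have [n ne] := archK e0; exists n => y xy; apply: eA => /=.
exact: lt_trans xy ne.
Qed.

Lemma open_norm_ball x (e : K) : open [set y | `|x - y| < e].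
Proof.
have H := ball_open x e; by rewrite -ball_normE in H.
Qed.

End Balls.

Section Baire.
Variables (K : numFieldType) (X : completeNormedModType K).
Hypothesis archK : inv_nat_cofinal K.
Implicit Types (x y : X) (F : (set X)^nat).

(** Nested balls of centers a_i and radii 1/(n_i+1). Each step asks that the ball
of twice the new radius lie in the previous ball and in [F i]: the limit of the
centers is only known to be within twice the radius of each of them, since its
distance to the centers is a limit of strict inequalities. *)
Theorem Baire_open_dense F :
  (forall i, open (F i)) -> (forall i, dense (F i)) -> dense (\bigcap_i F i).
Proof.
move=> oF dF D [x0 Dx0] oD.
have [n0 Dn0] := open_ball_inside archK oD Dx0.
have step (s : nat * (X * nat)) : exists t : X * nat, (s.1 <= t.2)%N /\
    forall y, `|t.1 - y| < t.2.+1%:R^-1 *+ 2 ->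
      `|s.2.1 - y| < s.2.2.+1%:R^-1 /\ F s.1 y.
  case: s => i [a n] /=.
  have [b [ab Fb]] : [set y | `|a - y| < n.+1%:R^-1] `&` F i !=set0.
    by apply: dF; [exists a; rewrite /= subrr normr0 invr_gt0|exact: open_norm_ball].
  have [m Hm] := open_ball_inside archK (openI (open_norm_ball a n.+1%:R^-1) (oF i)) (conj ab Fb).
  exists (b, maxn i (m.*2.+1)); rewrite leq_maxl; split => // y /= yb.
  apply: Hm; apply: (lt_le_trans yb).
  rewrite -[_ *+ 2]mulr_natr ler_pdivrMl// ler_pdivlMr// -natrM ler_nat.
  by rewrite mul2n doubleS ltnS leq_maxr.
have [f Hf] := choice step.
pose s := fix s i := if i is j.+1 then f (j, s j) else (x0, n0.*2.+1)%N.
pose r i : K := (s i).2.+1%:R^-1.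
have Hs i y : `|(s i.+1).1 - y| < r i.+1 *+ 2 -> `|(s i).1 - y| < r i /\ F i y.
  by have [_] := Hf (i, s i); apply.
have r_gt0 i : 0 < r i by rewrite invr_gt0.
have r_lt2 i : r i < r i *+ 2 by rewrite mulr2n ltrDl.
have nest i j y : (i <= j)%N -> `|(s j).1 - y| < r j -> `|(s i).1 - y| < r i.
  elim: j => [|j IH]; first by rewrite leqn0 => /eqP->.
  rewrite leq_eqVlt => /orP[/eqP->//|ij jy]; apply: IH => //.
  by have [] := Hs j y (lt_trans jy (r_lt2 _)).
have near_s i j : (i <= j)%N -> `|(s i).1 - (s j).1| < r i.
  by move=> ij; apply: nest ij _; rewrite subrr normr0.
have /cauchy_cvg/cvg_ex[l sl] : cauchy ((fun i => (s i).1) @ \oo).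
  apply: cauchy_exP => e e0; have [n ne] := archK e0.
  exists (s n.+1).1; exists n.+1 => // m /= nm.
  rewrite -ball_normE /=; apply: (lt_trans (near_s _ _ nm)).
  apply: le_lt_trans ne; rewrite lef_pV2 ?posrE// ler_nat ltnS.
  by have [] := Hf (n, s n).
have sl2 i : `|(s i).1 - l| < r i *+ 2.
  have /cvgrPdist_lt/(_ _ (r_gt0 i))[N _ HN] := sl.
  have := HN (maxn N i) (leq_maxl _ _) => /= li.
  have := ler_distD (s (maxn N i)).1 (s i).1 l => /le_lt_trans; apply.
  by rewrite mulr2n ltrD ?near_s ?leq_maxr// distrC.
exists l; split; last by move=> i _; have [] := Hs i l (sl2 _).
apply: Dn0; have [+ _] := Hs 0%N l (sl2 1%N); rewrite /r /= => /lt_le_trans; apply.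
by rewrite lef_pV2 ?posrE// ler_nat ltnS leqW// -addnn leq_addr.
Qed.

(** A double intersection of open dense sets, reindexed by pairing. *)
Lemma generic_bigcap (P : nat -> set X) :
  (forall i, generic (P i)) -> generic (\bigcap_i P i).
Proof.
move=> gP; have [G HG] := choice gP.
have GF i : exists F : nat -> set X,
    (forall j, open (F j)) /\ G i = \bigcap_j F j.
  by have [[F oF GF] _ _] := HG i; exists F.
have [F HF] := choice GF.
pose H n := if (unpickle n : option (nat * nat)) is Some ij then F ij.1 ij.2 else setT.
have oH n : open (H n).
  rewrite /H; case: unpickle => [[i j]|]; last exact: openT.
  by have [] := HF i.
exists (\bigcap_n H n); split; first by exists H.
- apply: Baire_open_dense => // n O O0 oO; rewrite /H.
  case: unpickle => [[i j]|]; last by rewrite setIT.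
  have [_ dG _] := HG i; have [y [Oy]] := dG _ O0 oO.
  by have [_ ->] := HF i => /(_ j I) Fy; exists y.
- move=> x Hx i _; have [_ _ GP] := HG i; apply: GP.
  have [_ ->] := HF i => j _.
  by have := Hx (pickle (i, j)) I; rewrite /H pickleK.
Qed.

Lemma open_dense_generic (P : set X) : open P -> dense P -> generic P.
Proof. by move=> oP dP; exists P; split => //; exact: open_Gdelta. Qed.

Lemma generic_sub (P Q : set X) : P `<=` Q -> generic P -> generic Q.
Proof.
by move=> PQ [G [gG dG GP]]; exists G; split => //; exact: subset_trans PQ.
Qed.

Lemma genericI (P Q : set X) : generic P -> generic Q -> generic (P `&` Q).
Proof.
move=> gP gQ.
have : generic (\bigcap_i (if i is 0%N then P else Q)).
  by apply: generic_bigcap => -[].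
by apply: generic_sub => x Hx; split; [exact: (Hx 0%N I)|exact: (Hx 1%N I)].
Qed.

Lemma generic_nonempty (P : set X) : generic P -> P !=set0.
Proof.
move=> [G [_ dG GP]].
by have [|x [_ /GP]] := dG setT _ openT; [exists 0|exists x].
Qed.

End Baire.

(** * Norms along an orbit *)

Section Norms.
Variables (K : numFieldType) (X : normedModType K).
Hypothesis archK : inv_nat_cofinal K.
Variable T : {linear X -> X}.
Implicit Types (x y : X) (j n : nat).

Definition small j : set X := [set y | `|y| < j.+1%:R^-1].
Definition large j : set X := [set y | j%:R < `|y|].

Lemma open_small j : open (small j).
Proof.
have := open_norm_ball (0 : X) (j.+1%:R^-1); congr open.
by apply/seteqP; split=> y /=; rewrite /small /= sub0r normrN.
Qed.

Lemma open_large j : open (large j).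
Proof.
rewrite openE => y /= jy; apply/nbhs_normP; exists (`|y| - j%:R); first by rewrite /= subr_gt0.
move=> z /= yz; rewrite /large /=.
have := lerB_dist y z => /le_lt_trans/(_ yz).
by rewrite ltrD2l ltrN2.
Qed.

Lemma small_nonincreasing i j : (i <= j)%N -> small j `<=` small i.
Proof.
by move=> ij y /lt_le_trans; apply; rewrite lef_pV2 ?posrE// ler_nat ltnS.
Qed.

Lemma large_nonincreasing i j : (i <= j)%N -> large j `<=` large i.
Proof. by move=> ij y; apply: le_lt_trans; rewrite ler_nat. Qed.

Lemma iter_linD n x y : iter n T (x + y) = iter n T x + iter n T y.
Proof. by elim: n => //= n ->; rewrite linearD. Qed.

Lemma iter_linZ n a x : iter n T (a *: x) = a *: iter n T x.
Proof. by elim: n => //= n ->; rewrite linearZ. Qed.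

Definition visits x (P : set X) : set nat := [set n | P (iter n T x)].

Lemma norm_cvg0P A x : norm_cvg0_along T A x <->
  forall j, exists N, forall k, (N < k)%N -> A k -> visits x (small j) k.
Proof.
rewrite /norm_cvg0_along; split=> [/cvgr0Pnorm_lt H j|H].
  have [|N _ HN] := H j.+1%:R^-1; first by rewrite invr_gt0.
  by exists N => k /ltnW Nk Ak; have := HN k Nk Ak; rewrite normr_id.
apply/cvgr0Pnorm_lt => e e0; have [j je] := archK e0; have [N HN] := H j.
exists N.+1 => // k /= Nk Ak; rewrite normr_id.
exact: lt_trans (HN k Nk Ak) je.
Qed.

Lemma real_le_nat (M : K) : M \is Num.real -> exists j, M <= j%:R.
Proof.
move=> Mr; have [M0|M0] := real_leP Mr (real0 K); first by exists 0%N.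
have [|j jM] := archK (e := M^-1); first by rewrite invr_gt0.
by exists j.+1; rewrite ltW// -ltf_pV2 ?posrE.
Qed.

Lemma norm_cvgyP A x : norm_cvgy_along T A x <->
  forall j, exists N, forall k, (N < k)%N -> A k -> visits x (large j) k.
Proof.
rewrite /norm_cvgy_along; split=> [H j|H].
  have /H [N _ HN] : \forall z \near (+oo : set_system K), j%:R < z.
    exact/nbhs_pinfty_gt/realn.
  by exists N => k /ltnW Nk Ak; exact: HN.
move=> P [M [Mr MP]]; have [j Mj] := real_le_nat Mr; have [N HN] := H j.
exists N.+1 => // k /= Nk Ak; apply: MP.
exact: le_lt_trans Mj (HN k Nk Ak).
Qed.

(** The bound M need not be nonnegative, nor even real when the space is
trivial; M |x| is nonnegative nonetheless, so |M| is a bound as well. *)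
Lemma bounded_operator_continuous : bounded_operator T -> continuous T.
Proof.
move=> [M HM] x; apply/cvgrPdist_lt => e e0.
have M0 : 0 < `|M| + 1 by rewrite ltr_wpDl.
apply/nbhs_normP; exists (e / (`|M| + 1)); first by rewrite /= divr_gt0.
move=> y /=; rewrite ltr_pdivlMr// mulrC => xy; rewrite -linearB.
apply: le_lt_trans xy.
have /ger0_norm <- : 0 <= `|T (x - y)| by [].
have H := HM (x - y); have : 0 <= M * `|x - y| by exact: le_trans H.
move=> /ger0_norm MN; rewrite normr_id (le_trans H)// -MN normrM normr_id.
by rewrite ler_wpM2r// lerDl.
Qed.

End Norms.

(** * Hypercyclic vectors *)

Section Hypercyclic.
Variables (R : realType) (K : numFieldType) (X : completeNormedModType K).
Hypothesis archK : inv_nat_cofinal K.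
Variable T : {linear X -> X}.
Hypothesis contT : continuous T.
Hypothesis sepX : separable X.
Implicit Types (x y : X) (j n : nat).

Lemma iter_continuous n : continuous (iter n T).
Proof.
elim: n => [|n IH] x; first exact: cvg_id.
rewrite (_ : iter n.+1 T = T \o iter n T)//.
by apply: continuous_comp; [exact: IH|exact: contT].
Qed.

Lemma open_iter_preimage n (P : set X) : open P -> open (iter n T @^-1` P).
Proof. by move=> oP; apply: open_comp => // x _; exact: iter_continuous. Qed.

Lemma open_setD1 (O : set X) x : open O -> open (O `\ x).
Proof.
move=> oO; apply: openI => //; apply: closed_openC.
apply: accessible_closed_set1; apply: hausdorff_accessible; exact: norm_hausdorff.
Qed.

Lemma open_setD1_nonempty (z : X) (O : set X) x : z != 0 -> open O -> O !=set0 ->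
  O `\ x !=set0.
Proof.
move=> z0 oO [y Oy]; have [xy|xy] := eqVneq y x; last by exists y; split=> //; exact/eqP.
have [n On] := open_ball_inside archK oO Oy.
have z_gt0 : 0 < `|z| by rewrite normr_gt0.
have a_gt0 : 0 < n.+2%:R^-1 / `|z| by rewrite divr_gt0// invr_gt0.
exists (y + (n.+2%:R^-1 / `|z|) *: z); split.
  apply: On; rewrite opprD addNKr normrN normrZ gtr0_norm// divfK ?gt_eqF//.
  by rewrite ltf_pV2 ?posrE// ltr_nat.
move=> /= /eqP; rewrite -xy -[X in _ == X]addr0 (inj_eq (addrI _)).
by rewrite scaler_eq0 gt_eqF//= (negbTE z0).
Qed.

(** In a nonzero space there are no isolated points, so the orbit stays dense
after deletion of its first m points; in the zero space there is nothing to
prove. *)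
Lemma hypercyclic_iter m x : hypercyclic_vector T x -> hypercyclic_vector T (iter m T x).
Proof.
move=> hx; have [[z z0]|X0] := pselect (exists z : X, z != 0); last first.
  suff -> : iter m T x = x by [].
  have eq0 y : y = 0 by apply/eqP; apply: contrapT => /negP ?; apply: X0; exists y.
  by rewrite [LHS]eq0 [RHS]eq0.
suff tail : dense [set iter n T x | n in [set n | (m <= n)%N]].
  move=> O O0 oO; have [y [Oy [n /= mn yn]]] := tail O O0 oO.
  exists (iter n T x); split; first by rewrite yn.
  by exists (n - m)%N => //; rewrite -iterD subnK.
elim: m => [|m IH] O O0 oO.
  by have [y [Oy [n _ ny]]] := hx O O0 oO; exists y; split => //; exists n.
have [y [[Oy ym] [n /= mn yn]]] := IH _ (open_setD1_nonempty (iter m T x) z0 oO O0)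
  (open_setD1 _ oO).
exists y; split => //; exists n => //=.
rewrite ltn_neqAle mn andbT; apply/eqP => nm; apply: ym.
by rewrite -yn nm.
Qed.

Lemma hypercyclicZ a x : a != 0 -> hypercyclic_vector T x ->
  hypercyclic_vector T (a *: x).
Proof.
move=> a0 hx O [u Ou] oO.
have [|y [Oy [n _ ny]]] := hx _ _ (open_comp (fun y _ => @scaler_continuous _ _ a y) oO).
  by exists (a^-1 *: u); rewrite /= scalerA divff// scale1r.
by exists (a *: y); split => //; exists n; rewrite // iter_linZ ny.
Qed.

(** An orbit is dense when it meets all the balls of radius 1/(j+1) centered at
a countable dense set. Each of these conditions is open, and satisfied by the
points of the orbit of x. *)
Lemma hypercyclic_generic x : hypercyclic_vector T x -> generic (hypercyclic_vector T).
Proof.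
move=> hx; have [D cD dD] := sepX.
have [d Dd] : exists d : nat -> X, D `<=` range d.
  have [->|[f]] := elimT pfcard_geP cD; first by exists (fun=> 0).
  by exists f; exact: surj.
pose U i j := [set y | exists n, `|d i - iter n T y| < j.+1%:R^-1].
have gU i j : generic (U i j).
  apply: open_dense_generic.
    rewrite (_ : U i j = \bigcup_n (iter n T @^-1` [set y | `|d i - y| < j.+1%:R^-1])).
      by apply: bigcup_open => n _; exact/open_iter_preimage/open_norm_ball.
    by apply/seteqP; split => y [n]; exists n.
  move=> O O0 oO; have [y [Oy [m _ my]]] := hx O O0 oO.
  exists (iter m T x); split; first by rewrite my.
  have [||w [dw [n _ nw]]] := @hypercyclic_iter m x hx [set y | `|d i - y| < j.+1%:R^-1].
    by exists (d i); rewrite /= subrr normr0 invr_gt0.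
    exact: open_norm_ball.
  by exists n; rewrite nw.
have /generic_bigcap : forall i, generic (\bigcap_j U i j).
  by move=> i; exact: generic_bigcap.
move=> /(_ archK); apply: generic_sub => y Uy O O0 oO.
have [e [Oe De]] := dD O O0 oO.
have [i _ die] := Dd _ De; rewrite -{}die in Oe.
have [j Oj] := open_ball_inside archK oO Oe.
have [n yn] := Uy i I j I.
by exists (iter n T y); split; [exact: Oj|exists n].
Qed.

(** The map y |-> z - y is its own inverse, and continuous. *)
Lemma generic_subl (P : set X) z : generic P -> generic [set y | P (z - y)].
Proof.
move=> [G [[F oF GF] dG GP]].
have cz : continuous (fun y : X => z - y).
  by move=> y; apply: cvgB; [exact: cvg_cst|exact: cvg_id].
exists [set y | G (z - y)]; split; last by move=> y /GP.
- exists (fun i => [set y | F i (z - y)]); first by move=> i; exact: open_comp.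
  by apply/seteqP; split => y /=; rewrite GF.
- move=> O [u Ou] oO.
  have [|y [Oy Gy]] := dG _ _ (open_comp (fun y _ => cz y) oO).
    by exists (z - u); rewrite /= subKr.
  by exists (z - y); split => //=; rewrite subKr.
Qed.

(** The generic sets of the hypercyclic y and of the y with z - y hypercyclic
intersect. *)
Lemma sum_of_hypercyclic x z : hypercyclic_vector T x ->
  exists y1 y2, [/\ hypercyclic_vector T y1, hypercyclic_vector T y2 & z = y1 + y2].
Proof.
move=> /hypercyclic_generic gT.
have [y [hy hzy]] := generic_nonempty (genericI archK gT (generic_subl z gT)).
by exists y, (z - y); split => //; rewrite addrC subrK.
Qed.

(** A visit to an open set at a given time persists under perturbation, and only
n times are concerned. *)
Lemma count_visits_near x (P : set X) n : open P ->
  \forall y \near x, (count_upto (visits T x P) n <= count_upto (visits T y P) n)%N.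
Proof.
move=> oP; elim: n => [|n IH].
  by apply: nearW => y; rewrite !count_upto0.
have : \forall y \near x, visits T x P n.+1 -> visits T y P n.+1.
  have [Px|Px] := pselect (visits T x P n.+1); last by apply: nearW.
  have : \forall y \near x, visits T y P n.+1.
    exact: open_nbhs_nbhs (conj (open_iter_preimage n.+1 oP) Px).
  by apply: filterS => y Py _.
apply: filterS2 IH => y IH xy; rewrite !count_uptoS leq_add//.
by have [/set_mem/xy h|//] := boolP (n.+1 \in visits T x P); rewrite (mem_set h).
Qed.

(** The condition is a countable intersection of the open sets [W i N]. The
visits of T^m x are the shifted visits of x, so these sets contain the dense orbit of
x. *)
Lemma generic_frequent c x (P : set X) : hypercyclic_vector T x -> open P ->
  frequent c (visits T x P) -> generic [set y | frequent (c : R) (visits T y P)].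
Proof.
move=> hx oP fx.
pose W i N := [set y | exists2 n, (N <= n)%N &
  (c - i.+1%:R^-1) * n%:R < (count_upto (visits T y P) n)%:R].
have gW i N : generic (W i N).
  apply: open_dense_generic.
    rewrite openE => y [n Nn yn]; near=> z; exists n => //.
    apply: (lt_le_trans yn); rewrite ler_nat; near: z.
    exact: count_visits_near.
  move=> O O0 oO; have [y [Oy [m _ my]]] := hx O O0 oO.
  exists y; split => //; have [|n Nn fn] := frequent_shift m fx (e := i.+1%:R^-1) N.
    by rewrite invr_gt0.
  exists n => //; apply: (lt_le_trans fn); rewrite ler_nat.
  by apply: count_upto_le_on => k _; rewrite /visits/= iterD my.
have /generic_bigcap : forall i, generic (\bigcap_N W i N).
  by move=> i; exact: generic_bigcap.
move=> /(_ archK); apply: generic_sub => y Wy e N e0.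
have [M HM] := inv_nat_eventually_lt e0.
have [n Nn yn] := Wy M I N I; exists n => //; apply: le_lt_trans yn.
by rewrite ler_wpM2r// lerD2l lerN2 ltW// HM.
Unshelve. all: by end_near. Qed.

Lemma generic_frequent_all c (P : nat -> set X) : (forall j, open (P j)) ->
  (forall j, exists2 x, hypercyclic_vector T x & frequent c (visits T x (P j))) ->
  generic [set y | forall j, frequent (c : R) (visits T y (P j))].
Proof.
move=> oP H.
have /(generic_bigcap archK) : forall j, generic [set y | frequent c (visits T y (P j))].
  by move=> j; have [x hx fx] := H j; exact: generic_frequent hx (oP j) fx.
by apply: generic_sub => y Hy j; exact: (Hy j I).
Qed.

End Hypercyclic.

(** * The four alternatives *)

Section Alternatives.
Variables (R : realType) (K : numFieldType) (X : completeNormedModType K).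
Hypothesis archK : inv_nat_cofinal K.
Variable T : {linear X -> X}.
Implicit Types (x y : X) (j n : nat) (A B : set nat) (c d : R).

(** At a large common time the norm would be less than 1 and greater than 1. *)
Lemma norm_cvg_disjoint A B x : (forall N, exists2 k, (N <= k)%N & A k /\ B k) ->
  norm_cvg0_along T A x -> norm_cvgy_along T B x -> False.
Proof.
move=> AB /(norm_cvg0P archK)/(_ 0%N)[N HN] /(norm_cvgyP archK)/(_ 1%N)[M HM].
have [k] := AB (maxn N M).+1.
rewrite gtn_max => /andP[Nk Mk] [Ak Bk].
have := HN _ Nk Ak; have := HM _ Mk Bk; rewrite /visits /small /large /= invr1.
by move=> /lt_trans h /h; rewrite ltxx.
Qed.

Lemma irregular2halfP x : distr_irregular2half T R x <->
  exists A B, [/\ exists2 c : R, 0 < c & frequent c A,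
    exists2 d : R, 0 < d & frequent d B, norm_cvg0_along T A x & norm_cvgy_along T B x].
Proof.
split=> [[A [B [AB Ax Bx]]]|
  [A [B [[c c0 /upper_density_geP cA] [d d0 /upper_density_geP dB] Ax Bx]]]].
  exists A, B; split => //.
    exists (upper_density R A); last exact/upper_density_geP.
    rewrite lt_neqAle upper_density_ge0 andbT eq_sym.
    by apply/eqP => uA; rewrite uA mul0r ltxx in AB.
  exists (upper_density R B); last exact/upper_density_geP.
  rewrite lt_neqAle upper_density_ge0 andbT eq_sym.
  by apply/eqP => uA; rewrite uA mulr0 ltxx in AB.
exists A, B; split => //.
by rewrite mulr_gt0// (lt_le_trans _ cA, lt_le_trans _ dB).
Qed.

Lemma irregular1_irregular2half x :
  distr_irregular1 T R x -> distr_irregular2half T R x.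
Proof. by move=> [A [B [uA uB Ax Bx]]]; exists A, B; rewrite uA uB mulr1. Qed.

Lemma asymptotic_not_irregular x : asymptotic_to_zero_density1 T R x ->
  ~ distr_irregular2half T R x.
Proof.
move=> [A /has_density1P nA Ax] /irregular2halfP[A' [B [_ [d d0 dB] _ Bx]]].
apply: norm_cvg_disjoint Ax Bx => N.
by have [k Nk [Bk Ak]] := frequent_meets_density1 d0 dB nA N; exists k.
Qed.

Lemma divergent_not_irregular x : divergent_to_infinity_density1 T R x ->
  ~ distr_irregular2half T R x.
Proof.
move=> [B /has_density1P nB Bx] /irregular2halfP[A [B' [[c c0 cA] _ Ax _]]].
exact: norm_cvg_disjoint (frequent_meets_density1 c0 cA nB) Ax Bx.
Qed.

Lemma asymptotic_not_divergent x : asymptotic_to_zero_density1 T R x ->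
  ~ divergent_to_infinity_density1 T R x.
Proof.
move=> [A dA Ax] [B /has_density1P nB Bx].
have /upper_density_geP fA : 1 <= upper_density R A by case: dA => ->.
exact: norm_cvg_disjoint (frequent_meets_density1 ltr01 fA nB) Ax Bx.
Qed.

Lemma frequent_small_cvg0 c x : (forall j, frequent c (visits T x (small j))) ->
  exists2 A, frequent c A & norm_cvg0_along T A x.
Proof.
move=> H; have [|A fA HA] := frequent_diagonal _ H.
  by move=> i j ij k; exact: small_nonincreasing.
by exists A => //; exact/norm_cvg0P.
Qed.

Lemma frequent_large_cvgy c x : (forall j, frequent c (visits T x (large j))) ->
  exists2 B, frequent c B & norm_cvgy_along T B x.
Proof.
move=> H; have [|B fB HB] := frequent_diagonal _ H.
  by move=> i j ij k; exact: large_nonincreasing.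
by exists B => //; exact/norm_cvgyP.
Qed.

Lemma negligible_asymptotic x :
  (forall j, negligible_set R (visits T x (~` small j))) ->
  asymptotic_to_zero_density1 T R x.
Proof.
move=> H; have [|//|A fA HA] := @negligible_diagonal R (fun j => visits T x (small j)).
  by move=> i j ij k; exact: small_nonincreasing.
by exists A; [exact/has_density1P|exact/norm_cvg0P].
Qed.

Lemma negligible_divergent x :
  (forall j, negligible_set R (visits T x (~` large j))) ->
  divergent_to_infinity_density1 T R x.
Proof.
move=> H; have [|//|A fA HA] := @negligible_diagonal R (fun j => visits T x (large j)).
  by move=> i j ij k; exact: large_nonincreasing.
by exists A; [exact/has_density1P|exact/norm_cvgyP].
Qed.

Lemma not_smallP j y : (~` small j) y <-> j.+1%:R^-1 <= `|y|.
Proof.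
rewrite /small /=; rewrite real_leNgt ?realV ?realn//.
by split=> /negP.
Qed.

Lemma not_largeP j y : (~` large j) y <-> `|y| <= j%:R.
Proof. by rewrite /large /= real_leNgt ?realn//; split=> /negP. Qed.

Lemma scale_not_small i j y : (~` small j) y -> large i ((j.+1 * i.+1)%:R *: y).
Proof.
move=> /not_smallP jy; rewrite /large /= normrZ normr_nat natrM mulrAC.
apply: (@lt_le_trans _ _ (j.+1%:R * j.+1%:R^-1 * i.+1%:R)).
  by rewrite divff// mul1r ltr_nat.
by rewrite ler_wpM2r// ler_wpM2l.
Qed.

Lemma scale_not_large i j y : (~` large j) y ->
  small i ((j.+1 * i.+1)%:R^-1 *: y).
Proof.
move=> /not_largeP jy; rewrite /small /= normrZ normfV normr_nat.
rewrite natrM invfM mulrAC gtr_pMl ?invr_gt0// mulrC ltr_pdivrMr// mul1r.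
by rewrite (le_lt_trans jy)// ltr_nat.
Qed.

Definition hypercyclic_visits_density1 (P : nat -> set X) :=
  forall x, hypercyclic_vector T x ->
    forall j, negligible_set R (visits T x (~` P j)).

Hypothesis contT : continuous T.
Hypothesis sepX : separable X.
Hypothesis hypT : hypercyclic T.

(** If the orbit of x stays d-frequently out of the ball [small j], then the
multiple (j+1)(i+1) x visits [large i] d-frequently. Since d does not depend on
i, the generic vector does so for all i. *)
Lemma not_negligible_generic_large :
  ~ hypercyclic_visits_density1 (@small K X) ->
  exists2 d : R, 0 < d & generic [set y | forall j, frequent d (visits T y (large j))].
Proof.
move=> /existsNP[x /not_implyP[hx /existsNP[j /not_negligible[d d0 fd]]]].
exists d => //; apply: generic_frequent_all => // [i|i]; first exact: open_large.
exists ((j.+1 * i.+1)%:R *: x); first by apply: hypercyclicZ hx; rewrite pnatr_eq0.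
apply: frequent_sub fd => k Sk.
by rewrite /visits /= iter_linZ; exact: scale_not_small.
Qed.

(** Symmetrically, x / ((j+1)(i+1)) visits [small i] as frequently as x stays in
the closed ball of radius j. *)
Lemma not_negligible_generic_small :
  ~ hypercyclic_visits_density1 (@large K X) ->
  exists2 c : R, 0 < c & generic [set y | forall j, frequent c (visits T y (small j))].
Proof.
move=> /existsNP[x /not_implyP[hx /existsNP[j /not_negligible[d d0 fd]]]].
exists d => //; apply: generic_frequent_all => // [i|i]; first exact: open_small.
exists ((j.+1 * i.+1)%:R^-1 *: x).
  by apply: hypercyclicZ hx; rewrite invr_eq0 pnatr_eq0.
apply: frequent_sub fd => k Sk.
by rewrite /visits /= iter_linZ; exact: scale_not_large.
Qed.

(** If |T^k (y1 + y2)| is at least 1/(j+1), then |T^k y1| or |T^k y2| is at least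
1/(2(j+1)), and this happens for a set of k of density zero. *)
Lemma all_asymptotic :
  hypercyclic_visits_density1 (@small K X) ->
  forall z, asymptotic_to_zero_density1 T R z.
Proof.
move=> H z; have [x hx] := hypT.
have [y1 [y2 [h1 h2 ->]]] := sum_of_hypercyclic archK contT sepX z hx.
apply: negligible_asymptotic => j.
apply: negligible_sub (negligibleU (H _ h1 j.*2.+1) (H _ h2 j.*2.+1)) => k /= Sk.
apply: contrapT => /not_orP[/contrapT s1 /contrapT s2]; apply: Sk.
rewrite iter_linD /small /= (le_lt_trans (ler_normD _ _))//.
have -> : j.+1%:R^-1 = j.*2.+2%:R^-1 + j.*2.+2%:R^-1 :> K.
  rewrite -doubleS -muln2 natrM invfM -mulrDr -[X in X = _]mulr1.
  by congr (_ * _); rewrite -mulr2n -[X in _ = X]mulr_natr mulVf.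
exact: ltrD s1 s2.
Qed.

Lemma irregular1_generic x : hypercyclic_vector T x -> distr_irregular1 T R x ->
  generic [set y | distr_irregular1 T R y].
Proof.
move=> hx [A [B [/upper_density_eq1P fA /upper_density_eq1P fB Ax Bx]]].
have gs : generic [set y | forall j, frequent (1 : R) (visits T y (small j))].
  apply: generic_frequent_all => // j; first exact: open_small.
  exists x => //; apply: frequent_eventually fA; exact: (norm_cvg0P archK _ _ _).1.
have gl : generic [set y | forall j, frequent (1 : R) (visits T y (large j))].
  apply: generic_frequent_all => // j; first exact: open_large.
  exists x => //; apply: frequent_eventually fB; exact: (norm_cvgyP archK _ _ _).1.
apply: generic_sub (genericI archK gs gl) => y [/frequent_small_cvg0[A' fA' Ay]].
move=> /frequent_large_cvgy[B' fB' By]; exists A', B'; split => //.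
  exact/upper_density_eq1P.
exact/upper_density_eq1P.
Qed.

Theorem orbit_alternatives : exactly_one_orbit_alternative R T.
Proof.
have [x0 hx0] := hypT; have gT := hypercyclic_generic archK contT sepX hx0.
split; [|split; split].
- have [/all_asymptotic|/not_negligible_generic_large[d d0 gl]] :=
    pselect (hypercyclic_visits_density1 (@small K X)).
    by constructor 1.
  have [H|/not_negligible_generic_small[c c0 gs]] :=
    pselect (hypercyclic_visits_density1 (@large K X)).
    by constructor 4 => x /H; exact: negligible_divergent.
  have [[x hx irr]|noirr] :=
    pselect (exists2 x, hypercyclic_vector T x & distr_irregular1 T R x).
    by constructor 2; exact: irregular1_generic irr.
  constructor 3; split; last by move=> x hx irr; apply: noirr; exists x.
  apply: generic_sub (genericI archK gs gl) => y [/frequent_small_cvg0[A fA Ay]].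
  move=> /frequent_large_cvgy[B fB By]; apply/irregular2halfP; exists A, B.
  by split => //; [exists c|exists d].
- move=> [as0 /generic_nonempty[x]] /irregular1_irregular2half.
  exact: asymptotic_not_irregular.
- by move=> [as0 [/generic_nonempty[x]]] + _; exact: asymptotic_not_irregular.
- by move=> [as0 /(_ _ hx0)]; exact: asymptotic_not_divergent.
- move=> [g [_ no]]; have [x [hx irr]] := generic_nonempty (genericI archK gT g).
  exact: no hx irr.
- move=> [g div]; have [x [/div dx irr]] := generic_nonempty (genericI archK gT g).
  exact: divergent_not_irregular dx (irregular1_irregular2half irr).
- move=> [[g _] div]; have [x [/div dx irr]] := generic_nonempty (genericI archK gT g).
  exact: divergent_not_irregular dx irr.
Qed.

End Alternatives.

Lemma real_inv_nat_cofinal (R : realType) : inv_nat_cofinal R.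
Proof.
by move=> e /inv_nat_eventually_lt[M HM]; exists M; exact: HM.
Qed.

(** In the order of complex numbers, a positive element is a positive real. *)
Lemma complex_inv_nat_cofinal (R : realType) : inv_nat_cofinal (complex R).
Proof.
move=> [a b]; rewrite ltcE /= => /andP[/eqP b0 a0].
have [n na] := real_inv_nat_cofinal a0; exists n.
rewrite b0 -(rmorph_nat (real_complex R)) -fmorphV.
by rewrite [ltRHS](_ : _ = a%:C%C)// ltcR.
Qed.

Theorem theorem1p1 (R : realType) :
  (forall (X : completeNormedModType R) (T : {linear X -> X}),
     separable X -> bounded_operator T -> hypercyclic T ->
     exactly_one_orbit_alternative R T) /\
  (forall (X : completeNormedModType (complex R)) (T : {linear X -> X}),
     separable X -> bounded_operator T -> hypercyclic T ->
     exactly_one_orbit_alternative R T).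
Proof.
split=> X T sepX /bounded_operator_continuous cT hT.
  by apply: orbit_alternatives => //; exact: real_inv_nat_cofinal.
by apply: orbit_alternatives => //; exact: complex_inv_nat_cofinal.
Qed.
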